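(* Let $\mathrm{Inv}\langle A \mid r_1=s_1,\ldots,r_m=s_m\rangle$ be a finite inverse monoid presentation, and let $w\in (A\cup A^{-1})^*$. If the Schützenberger graph $\mathcal S(w)$ is tree-like, then $\mathrm{Geo}(w)$ is a rational language over $A\cup A^{-1}$.
   Context: An inverse monoid is a monoid in which every element $s$ has a unique $s^{-1}$ with $ss^{-1}s=s$ and $s^{-1}ss^{-1}=s^{-1}$. Let $A^{-1}$ be a set of formal inverses of $A$, disjoint from $A$, and give $(A\cup A^{-1})^*$ the obvious involution $w\mapsto w^{-1}$. The inverse monoid $M=\mathrm{Inv}\langle A\mid R\rangle$, $R\subseteq (A\cup A^{-1})^*\times(A\cup A^{-1})^*$, is the quotient of $(A\cup A^{-1})^*$ by the congruence $\tau$ generated by $R$ and all pairs $(uu^{-1}u,u)$, $(uu^{-1}vv^{-1},vv^{-1}uu^{-1})$. The presentation is finite if $A$ and $R$ are finite. The Cayley graph of $M$ with respect to $A$ has vertex set $M$ and an edge labeled $a$ from $s$ to $sa$ for all $s\in M$, $a\in A\cup A^{-1}$. The Schützenberger graph $\mathcal S(w)$ is the strongly connected component of this Cayley graph containing $w\tau$ (its vertices are the $s\in M$ with $ss^{-1}=(ww^{-1})\tau$). Its edges occur in inverse pairs, and its vertex set is a metric space, $d(u,v)$ being the length of a shortest path from $u$ to $v$. A connected graph with edges in inverse pairs is tree-like if (with its path metric on vertices) it is quasi-isometric to a tree. $\mathrm{Geo}(w)$ is the set of all $u\in(A\cup A^{-1})^*$ such that $u$ labels a path in $\mathcal S(w)$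 from $(ww^{-1})\tau$ to $(ww^{-1}u)\tau$ and $u$ has minimum length among all words labeling paths from $(ww^{-1})\tau$ to $(ww^{-1}u)\tau$ in $\mathcal S(w)$. A language is rational if it is the language accepted by some finite automaton. *)

(* Defs.v *)
From HB Require Import structures.
From mathcomp Require Import all_boot all_order all_algebra.
From mathcomp Require Import boolp classical_sets reals.

Set Implicit Arguments.
Unset Strict Implicit.
Unset Printing Implicit Defensive.

Import GRing.Theory Num.Theory.

Local Open Scope classical_set_scope.
Local Open Scope quotient_scope.
Local Open Scope ring_scope.

(* [inl a] is the letter a of A and [inr a] its formal inverse. *)
Definition letter (A : finType) : finType := (A + A)%type.
Definition word (A : finType) := seq (letter A).

Definition invl (A : finType) (x : letter A) : letter A :=
  match x with inl a => inr a | inr a => inl a end.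
Definition invw (A : finType) (u : word A) : word A := rev (map (@invl A) u).

(* The congruence generated by the defining relations together with the
   Wagner (free inverse monoid) relations. *)
Inductive tau (A : finType) (R : seq (word A * word A)) :
    word A -> word A -> Prop :=
| tau_rel u v : (u, v) \in R -> tau R u v
| tau_inv u : tau R (u ++ invw u ++ u) u
| tau_comm u v :
    tau R (u ++ invw u ++ v ++ invw v) (v ++ invw v ++ u ++ invw u)
| tau_refl u : tau R u u
| tau_sym u v : tau R u v -> tau R v u
| tau_trans u v t : tau R u v -> tau R v t -> tau R u t
| tau_cat u u' v v' : tau R u u' -> tau R v v' -> tau R (u ++ v) (u' ++ v').

Section InverseMonoid.
Variables (A : finType) (R : seq (word A * word A)).

Definition taub : rel (word A) := fun u v => `[< tau R u v >].

Lemma taub_refl : reflexive taub.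
Proof. by move=> u; apply/asboolP; exact: tau_refl. Qed.

Lemma taub_sym : symmetric taub.
Proof. by move=> u v; apply/asboolP/asboolP; exact: tau_sym. Qed.

Lemma taub_trans : transitive taub.
Proof.
move=> v u t /asboolP uv /asboolP vt; apply/asboolP; exact: tau_trans uv vt.
Qed.

Canonical taub_equiv : equiv_rel (word A) :=
  EquivRel taub taub_refl taub_sym taub_trans.

Definition Inv := {eq_quot taub}.
HB.instance Definition _ := Choice.on Inv.
HB.instance Definition _ := EqQuotient.on Inv.

Definition cls (u : word A) : Inv := \pi_Inv u.

Lemma clsP (u v : word A) : cls u = cls v <-> tau R u v.
Proof.
by split => [/eqquotP/asboolP | uv] //; apply/eqquotP/asboolP.
Qed.

Lemma cls_repr (s : Inv) : cls (repr s) = s.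
Proof. exact: reprK. Qed.

Lemma tau_repr (u : word A) : tau R (repr (cls u)) u.
Proof. by apply/clsP; rewrite cls_repr. Qed.

Definition Inv_mul (s t : Inv) : Inv := cls (repr s ++ repr t).

Lemma cls_cat (u v : word A) : cls (u ++ v) = Inv_mul (cls u) (cls v).
Proof.
by apply/clsP/tau_cat; apply: tau_sym; exact: tau_repr.
Qed.

Fact Inv_mulA : associative Inv_mul.
Proof.
move=> s t r; rewrite -(cls_repr s) -(cls_repr t) -(cls_repr r).
by rewrite -!cls_cat catA.
Qed.

Fact Inv_mul1 : left_id (cls [::]) Inv_mul.
Proof. by move=> s; rewrite -(cls_repr s) -cls_cat. Qed.

Fact Inv_mulr1 : right_id (cls [::]) Inv_mul.
Proof. by move=> s; rewrite -(cls_repr s) -cls_cat cats0. Qed.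

HB.instance Definition _ :=
  isMonoid.Build Inv Inv_mulA Inv_mul1 Inv_mulr1.

End InverseMonoid.

(* Directed graphs with edges labelled in L, possibly infinite. *)
Record lgraph (L : Type) := LGraph {
  lvert : choiceType;
  ledge : lvert -> L -> lvert -> Prop
}.

(* [walk e x u y]: u labels an e-path from x to y. *)
Fixpoint walk (L V : Type) (e : V -> L -> V -> Prop)
    (x : V) (u : seq L) (y : V) : Prop :=
  match u with
  | [::] => x = y
  | a :: u' => exists z, e x a z /\ walk e z u' y
  end.

Section LabelledGraphs.
Variables (L : Type) (G : lgraph L).

Definition mutually_reachable (x y : lvert G) : Prop :=
  (exists u, walk (@ledge L G) x u y) /\ (exists u, walk (@ledge L G) y u x).

Definition strong_component (x : lvert G) : lgraph L :=
  @LGraph L {y : lvert G | `[< mutually_reachable x y >]}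
    (fun y a z => ledge (val y) a (val z)).

Definition adj : rel (lvert G) := fun x y => `[< exists a, ledge x a y >].

End LabelledGraphs.

Definition cayley (A : finType) (R : seq (word A * word A)) :
    lgraph (letter A) :=
  @LGraph (letter A) (Inv R) (fun s a t => t = (s * cls R [:: a])%g).

Definition schutzenberger (A : finType) (R : seq (word A * word A))
    (w : word A) : lgraph (letter A) :=
  @strong_component _ (cayley R) (cls R w).

Definition Geo (A : finType) (R : seq (word A * word A)) (w : word A) :
    set (word A) :=
  [set u | exists x y : lvert (schutzenberger R w),
    [/\ val x = cls R (w ++ invw w),
        val y = cls R (w ++ invw w ++ u),
        walk (@ledge _ (schutzenberger R w)) x u y &
        forall v, walk (@ledge _ (schutzenberger R w)) x v y ->
          (size u <= size v)%N]].

Section PathMetric.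
Variables (V : eqType) (e : rel V).

Definition path_of_length (x y : V) : pred nat :=
  fun n => `[< exists p, [/\ path e x p, last x p = y & size p = n] >].

(* The length of a shortest path from x to y; the value 0 used when there is
   no path is irrelevant for connected graphs. *)
Definition path_dist (x y : V) : nat :=
  if pselect (exists n, path_of_length x y n) is left h then ex_minn h else 0%N.

Definition is_tree : Prop :=
  [/\ symmetric e,
      irreflexive e,
      forall x y, exists2 p, path e x p & last x p = y &
      (* no simple cycle of length at least 3 *)
      forall c, ucycle e c -> (size c <= 2)%N].

End PathMetric.

Definition quasi_isometric (K : realType)
    (X : Type) (dX : X -> X -> K) (Y : Type) (dY : Y -> Y -> K) : Prop :=
  exists (f : X -> Y) (k eps C : K),
    [/\ 1 <= k, 0 <= eps, 0 <= C,
        forall x x', k^-1 * dX x x' - eps <= dY (f x) (f x')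
                  /\ dY (f x) (f x') <= k * dX x x' + eps &
        forall y, exists x, dY y (f x) <= C].

(* Meant for connected graphs with edges in inverse pairs, i.e. connected and
   symmetric e. *)
Definition tree_like (K : realType) (V : eqType) (e : rel V) : Prop :=
  exists (T : eqType) (t : rel T), is_tree t /\
    quasi_isometric (fun x y : V => (path_dist e x y)%:R : K)
                    (fun x y : T => (path_dist t x y)%:R : K).

Record automaton (L : finType) := Automaton {
  astate : finType;
  ainit : {set astate};
  afinal : {set astate};
  atrans : astate -> L -> astate -> bool
}.

Definition accepted (L : finType) (N : automaton L) : set (seq L) :=
  [set u | exists i f : astate N,
    [/\ i \in ainit N, f \in afinal N & walk (@atrans L N) i u f]].

Definition rational_language (L : finType) (X : set (seq L)) : Prop :=
  exists N : automaton L, X = accepted N.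

(* Main.v *)
Require Import Defs.
From mathcomp Require Import all_boot all_order all_algebra.
From mathcomp Require Import boolp classical_sets reals.
From mathcomp Require Import zify lra.

Set Implicit Arguments.
Unset Strict Implicit.
Unset Printing Implicit Defensive.

(** The Schützenberger graph S is initial among the inverse graphs that satisfy
the relations of R and in which w can be read from the base point. Let d be the
distance to the base point o. The words continuing a geodesic from o to v to a
longer geodesic form the cone of v, and by Myhill-Nerode it suffices that there
are finitely many cones.

Let Y(v) be the set of vertices reachable from v without coming closer to o than
v. As S is a quasi-tree, all boundary vertices of Y(v) lie within a distance D of
v that does not depend on v. Suppose that the balls of a large radius around v1
and v2 are isomorphic, compatibly with Y(v1) and Y(v2). Take S and S x S, cut S
along the boundary of Y(v1) and S x S along the corresponding part of the graph
of the ball isomorphism, and glue the two crosswise. Relators are short, so those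
that meet the cut live inside the balls; hence the result is again an inverse
graph satisfying R, and S maps to it by initiality. After the cut this map has
two components, so words that can be read from v1 inside Y(v1) can also be read
from v2, with the same coincidences of end points. By symmetry Y(v1) and Y(v2)
are isomorphic by an isomorphism matching boundaries. Geodesics from o to Y(v)
enter Y(v) through vertices at distance d(v) from o, so the cones agree. *)

(** * Walks, inverse graphs and Schützenberger graphs *)

Section Walks.
Variables (L V : Type) (e : V -> L -> V -> Prop).

Definition deterministic := forall x a y y', e x a y -> e x a y' -> y = y'.

Definition within (P : V -> Prop) (x : V) (a : L) (y : V) :=
  [/\ P x, P y & e x a y].

Lemma walk_cat x u v y :
  walk e x (u ++ v) y <-> exists2 z, walk e x u z & walk e z v y.
Proof.
elim: u x => [|a u IH] x /=.
  by split=> [|[z -> //]]; exists x.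
split=> [[z [xz /IH[t zt ty]]]|[t [z [xz zt]] ty]].
  by exists t => //; exists z.
by exists z; split=> //; apply/IH; exists t.
Qed.

Lemma walk1 x a y : walk e x [:: a] y <-> e x a y.
Proof. by split=> [[z [xz <-]]|xy] //; exists y. Qed.

Lemma walk_rcons x u a y :
  walk e x (rcons u a) y <-> exists2 z, walk e x u z & e z a y.
Proof.
rewrite -cats1 walk_cat.
by split=> -[z xz zy]; exists z => //; apply/walk1.
Qed.

Lemma walk_det x u y y' :
  deterministic -> walk e x u y -> walk e x u y' -> y = y'.
Proof.
move=> det; elim: u x => [|a u IH] x /=; first by move=> <-.
by move=> [z [xz zy]] [z' [/(det _ _ _ _ xz) <- /(IH _ zy)]].
Qed.

Lemma walk_within P x u y : walk (within P) x u y -> walk e x u y.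
Proof.
elim: u x => [|a u IH] x //= [z [[_ _ xz] /IH zy]].
by exists z.
Qed.

Lemma within_end P x u y : P x -> walk (within P) x u y -> P y.
Proof.
elim: u x => [|a u IH] x Px /=; first by move=> <-.
by move=> [z [[_ Pz _] /(IH _ Pz)]].
Qed.

End Walks.

Lemma walk_sub (L V : Type) (e e' : V -> L -> V -> Prop) x u y :
  (forall x a y, e x a y -> e' x a y) -> walk e x u y -> walk e' x u y.
Proof.
move=> ee'; elim: u x => [|a u IH] x //= [z [xz /IH zy]].
by exists z; split=> //; exact: ee'.
Qed.

Section InverseGraphs.
Variables (A : finType) (R : seq (word A * word A)).

Definition inverse_graph (V : Type) (e : V -> letter A -> V -> Prop) :=
  deterministic e /\ forall x a y, e x a y -> e y (invl a) x.

Definition satisfies (V : Type) (e : V -> letter A -> V -> Prop) :=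
  forall u v, (u, v) \in R -> forall x y, walk e x u y <-> walk e x v y.

Lemma invlK : involutive (@invl A).
Proof. by case. Qed.

Lemma invwK : involutive (@invw A).
Proof. by move=> u; rewrite /invw map_rev revK mapK //; exact: invlK. Qed.

Lemma invw_cat (u v : word A) : invw (u ++ v) = invw v ++ invw u.
Proof. by rewrite /invw map_cat rev_cat. Qed.

Lemma invw_cons a (u : word A) : invw (a :: u) = rcons (invw u) (invl a).
Proof. by rewrite /invw /= rev_cons. Qed.

Section OneGraph.
Variables (V : Type) (e : V -> letter A -> V -> Prop).
Hypothesis inv_e : inverse_graph e.

Lemma edgeC x a y : e x a y <-> e y (invl a) x.
Proof. by case: inv_e => _ inv; split=> /inv //; rewrite invlK. Qed.

Lemma walkV x u y : walk e x u y -> walk e y (invw u) x.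
Proof.
elim: u x => [|a u IH] x /=; first by move=> ->.
move=> [z [/edgeC zx /IH yz]]; rewrite invw_cons.
by apply/walk_rcons; exists z.
Qed.

Lemma within_inverse P : inverse_graph (within e P).
Proof.
split=> [x a y y' [_ _ xy] [_ _ xy']|x a y [Px Py /edgeC yx]] //.
exact: inv_e.1 xy xy'.
Qed.

(** Determinism forces the way back to retrace the way out, so idempotents act as partial
    identities. Hence the Wagner relations hold in every inverse graph. *)
Lemma walk_idempotent x u y :
  walk e x (u ++ invw u) y <-> x = y /\ exists z, walk e x u z.
Proof.
split=> [/walk_cat[z xz zy]|[<- [z xz]]].
  split; last by exists z.
  exact: walk_det inv_e.1 (walkV xz) zy.
by apply/walk_cat; exists z => //; exact: walkV.
Qed.

Lemma tau_walk u v :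
  satisfies e -> tau R u v -> forall x y, walk e x u y <-> walk e x v y.
Proof.
move=> Re; elim=> {u v} [u v /Re //|u|u v|//|u v _ IH|u v t _ IH1 _ IH2
  |u u' v v' _ IH1 _ IH2] x y.
- rewrite catA; split=> [/walk_cat[z /walk_idempotent[-> _]]//|xy].
  apply/walk_cat; exists x => //; apply/walk_idempotent; split=> //.
  by exists y.
- suff {u v x y} half u v x y : walk e x (u ++ invw u ++ v ++ invw v) y ->
      walk e x (v ++ invw v ++ u ++ invw u) y by split; exact: half.
  rewrite catA => /walk_cat[z /walk_idempotent[<- xu]].
  move=> /walk_idempotent[<- xv].
  by rewrite catA; apply/walk_cat; exists x; apply/walk_idempotent.
- by rewrite IH.
- by rewrite IH1.
- by split=> /walk_cat[z xz zy]; apply/walk_cat; exists z;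
     by [apply/IH1|apply/IH2].
Qed.

End OneGraph.
End InverseGraphs.

Section InverseMonoid.
Variables (A : finType) (R : seq (word A * word A)).
Local Notation c := (cls R).
Local Open Scope group_scope.

Lemma clsM u v : c (u ++ v) = c u * c v.
Proof. exact: cls_cat. Qed.

Lemma clsK u : c u * c (invw u) * c u = c u.
Proof. by rewrite -!clsM -catA; apply/clsP; exact: tau_inv. Qed.

Lemma cls_comm u v :
  c u * c (invw u) * (c v * c (invw v)) = c v * c (invw v) * (c u * c (invw u)).
Proof.
by rewrite -!clsM; apply/clsP; rewrite -!catA; exact: tau_comm.
Qed.

(* [tau] is not closed under [invw] by definition: this is the uniqueness of
   inverses. *)
Lemma cls_invw u v : c u = c v -> c (invw u) = c (invw v).
Proof.
move=> uv; have := clsK (invw u); have := clsK (invw v); rewrite !invwK.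
have := cls_comm (invw v) (invw u); rewrite !invwK.
have := cls_comm u v; have := clsK v; rewrite uv.
set q := c v; set x := c (invw u); set y := c (invw v).
move=> qyq comm1 comm2 yqy xqx.
transitivity (y * q * x).
  by rewrite -{1}xqx -{1}qyq !mulgA -(mulgA (x * q)) -comm2 -!mulgA (mulgA x) xqx.
have qxq : q * x * q = q by rewrite /q -uv; exact: clsK.
by rewrite -{2}yqy -{2}qxq -!mulgA (mulgA q x) comm1 !mulgA yqy.
Qed.

(** Inverting ps = p gives s^-1 p^-1 = p^-1. Now insert p = p p^-1 p and commute p^-1 p with s
    s^-1. *)
Lemma cls_fixed p s : c p * c s = c p -> c p * c s * c (invw s) = c p.
Proof.
move=> ps; have := @cls_invw (p ++ s) p; rewrite invw_cat !clsM => /(_ ps) sp.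
have := cls_comm (invw p) s; rewrite invwK => comm.
by rewrite -{1}(clsK p) -!mulgA (mulgA _ (c p)) comm !mulgA ps -(mulgA _ _ (c (invw p)))
  sp clsK.
Qed.

(** The idempotent of uv fixes p by [cls_fixed] and lies below that of u, which therefore fixes p
    too. This makes the edges of a strong component reversible. *)
Lemma cls_path p u v :
  c p * c u * c v = c p -> c p * c u * c (invw u) = c p.
Proof.
move=> puv.
have absorb : c u * c (invw u) * (c (u ++ v) * c (invw (u ++ v))) =
    c (u ++ v) * c (invw (u ++ v)).
  by rewrite clsM !mulgA clsK.
have E : c p * (c (u ++ v) * c (invw (u ++ v))) = c p.
  by rewrite mulgA cls_fixed // clsM mulgA.
by rewrite -mulgA -{1}E -mulgA cls_comm absorb.
Qed.

End InverseMonoid.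

(** * Schützenberger graphs and their initiality *)

Section Schutzenberger.
Variables (A : finType) (R : seq (word A * word A)) (w : word A).
Local Notation c := (cls R).
Local Notation S := (schutzenberger R w).
Local Notation edge := (@ledge _ S).
Local Open Scope group_scope.

Lemma walk_cayley (s t : Inv R) u :
  walk (@ledge _ (cayley R)) s u t <-> t = s * c u.
Proof.
elim: u s => [|a u IH] s /=.
  by rewrite mulg1; split=> ->.
rewrite -[a :: u]/([:: a] ++ u) clsM mulgA.
by split=> [[z [-> /IH]]|/IH tE] //; exists (s * c [:: a]).
Qed.

Local Notation component :=
  (fun s => is_true `[< mutually_reachable (c w : lvert (cayley R)) s >]).

Lemma schutzenberger_mem (s : Inv R) :
  `[< mutually_reachable (c w : lvert (cayley R)) s >] <->
  exists u v, s = c (w ++ u) /\ c w = s * c v.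
Proof.
split=> [/asboolP[[u /walk_cayley ->] [v /walk_cayley wE]]|[u [v [-> wE]]]].
  by exists u, v; rewrite clsM.
apply/asboolP; split; [exists u|exists v]; apply/walk_cayley => //.
by rewrite clsM.
Qed.

(** Whatever lies on a path between two vertices of a strong component belongs to it, so a product
    ending in the component is read entirely inside it. *)
Lemma walk_schutzenberger (x y : lvert S) u :
  walk edge x u y <-> val y = val x * c u.
Proof.
elim: u x => [|a u IH] x /=.
  by rewrite mulg1; split=> [->|/val_inj].
rewrite -[a :: u]/([:: a] ++ u) clsM mulgA; split.
  by move=> [z [zE /IH ->]]; congr (_ * _); exact: zE.
move=> yE.
have /schutzenberger_mem zP : exists p v,
    val x * c [:: a] = c (w ++ p) /\ c w = val x * c [:: a] * c v.
  have /schutzenberger_mem[p [_ [xE _]]] := valP x.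
  have /schutzenberger_mem[_ [v [_ wE]]] := valP y.
  exists (p ++ [:: a]), (u ++ v); rewrite catA clsM -xE; split=> //.
  by rewrite clsM mulgA -yE.
exists (exist component _ zP); split=> //.
by apply/IH.
Qed.

Lemma schutzenberger_inverse : inverse_graph edge.
Proof.
split=> [x a y y' xy xy'|x a y xy].
  by apply: val_inj; rewrite xy xy'.
have /schutzenberger_mem[p [_ [xE _]]] := valP x.
have /schutzenberger_mem[q [v [_ wE]]] := valP y.
have yE : val y = val x * c [:: a] by exact: xy.
(* A loop at [x] through [y]: the letter [a], then [v] back to the class of [w], then [p] to [x]. *)
have /cls_path : c (w ++ p) * c [:: a] * c (v ++ p) = c (w ++ p).
  have vp : c (v ++ p) = c v * c p by exact: clsM.
  have wp : c w * c p = c (w ++ p) by rewrite clsM.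
  rewrite vp -wp in xE *.
  by rewrite -xE -yE mulgA -wE xE.
by move=> E; rewrite /ledge /= yE xE E.
Qed.

Lemma schutzenberger_satisfies : satisfies R edge.
Proof.
move=> u v uv x y; rewrite !walk_schutzenberger.
by have /clsP -> : tau R u v by exact: tau_rel.
Qed.

Lemma schutzenberger_connected (x y : lvert S) : exists u, walk edge x u y.
Proof.
have /schutzenberger_mem[_ [v [_ wE]]] := valP x.
have /schutzenberger_mem[u [_ [yE _]]] := valP y.
by exists (v ++ u); apply/walk_schutzenberger; rewrite clsM mulgA -wE yE clsM.
Qed.

Lemma base_mem :
  `[< mutually_reachable (c w : lvert (cayley R)) (c (w ++ invw w)) >].
Proof.
apply/schutzenberger_mem; exists (invw w), w; split=> //.
by rewrite clsM clsK.
Qed.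

Definition base : lvert S := exist component _ base_mem.

Lemma base_readable : exists x, walk edge base w x.
Proof.
have wP : component (c w) by apply/schutzenberger_mem; exists [::], [::];
  rewrite cats0 mulg1.
exists (exist component _ wP); apply/walk_schutzenberger.
by rewrite /= clsM clsK.
Qed.

Section Initial.
Variables (V : Type) (e : V -> letter A -> V -> Prop) (x0 : V).
Hypotheses (inv_e : inverse_graph e) (Re : satisfies R e).
Hypothesis wx0 : exists x, walk e x0 w x.

(** Connectedness closes u up to a loop uv at the base, so w w^-1 u v and w w^-1 are [tau]-related.
    The latter is readable at [x0], hence so is u. *)
Lemma initial_readable u y : walk edge base u y -> exists x, walk e x0 u x.
Proof.
move=> /walk_schutzenberger yE.
have [v /walk_schutzenberger vE] := schutzenberger_connected y base.
have /clsP E : c ((w ++ invw w) ++ u ++ v) = c (w ++ invw w).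
  by rewrite !(clsM, mulgA) -clsM -yE -vE.
have: walk e x0 (w ++ invw w) x0 by apply/(walk_idempotent inv_e).
move=> /(tau_walk inv_e Re E) /walk_cat[z /(walk_idempotent inv_e)[<- _]].
by move=> /walk_cat[x xu _]; exists x.
Qed.

Lemma initial_eq u u' y x :
  walk edge base u y -> walk edge base u' y -> walk e x0 u x -> walk e x0 u' x.
Proof.
move=> /walk_schutzenberger yE /walk_schutzenberger yE' xu.
have /clsP E : c ((w ++ invw w) ++ u) = c ((w ++ invw w) ++ u').
  by rewrite (clsM R _ u) (clsM R _ u'); exact: etrans (esym yE) yE'.
have: walk e x0 ((w ++ invw w) ++ u) x.
  by apply/walk_cat; exists x0 => //; apply/(walk_idempotent inv_e).
by move=> /(tau_walk inv_e Re E) /walk_cat[z /(walk_idempotent inv_e)[<- _]].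
Qed.

End Initial.
End Schutzenberger.

(** * Bottlenecks in quasi-trees *)

Section Distance.
Variables (V : eqType) (e : rel V).
Implicit Types (x y z : V) (p : seq V).

Definition joined x y := exists2 p, path e x p & last x p = y.

Lemma joined_trans y x z : joined x y -> joined y z -> joined x z.
Proof.
by move=> [p xp py] [q yq qz]; exists (p ++ q);
  rewrite ?cat_path ?last_cat py ?xp.
Qed.

Lemma joined_sym : symmetric e -> forall x y, joined x y -> joined y x.
Proof.
move=> sym_e x y [p xp <-]; exists (rev (belast x p)).
  by rewrite rev_path (eq_path (e' := e)) // => a b; exact: sym_e.
by case: p {xp} => //= z p; rewrite rev_cons last_rcons.
Qed.

Lemma path_dist_le x p : path e x p -> path_dist e x (last x p) <= size p.
Proof.
move=> xp; rewrite /path_dist.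
have pP : path_of_length e x (last x p) (size p) by apply/asboolP; exists p.
by case: pselect => [h|[]]; [case: ex_minnP => n _; exact|exists (size p)].
Qed.

Lemma path_distP x y :
  joined x y -> exists p, [/\ path e x p, last x p = y & size p = path_dist e x y].
Proof.
move=> [p xp py]; rewrite /path_dist.
case: pselect => [h|[]]; first by case: ex_minnP => n /asboolP.
by exists (size p); apply/asboolP; exists p.
Qed.

Lemma path_dist_refl x : path_dist e x x = 0.
Proof. by apply/eqP; rewrite -leqn0 (@path_dist_le x [::]). Qed.

Lemma path_dist_triangle x y z : joined x y -> joined y z ->
  path_dist e x z <= path_dist e x y + path_dist e y z.
Proof.
move=> /path_distP[p [xp <- <-]] /path_distP[q [yq <- <-]].
by rewrite -last_cat -size_cat path_dist_le // cat_path xp.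
Qed.

Lemma path_dist_sym : symmetric e -> forall x y, joined x y ->
  path_dist e x y = path_dist e y x.
Proof.
move=> sym_e.
suff half x y : joined x y -> path_dist e y x <= path_dist e x y.
  by move=> x y xy; apply/eqP; rewrite eqn_leq !half //; exact: joined_sym.
move=> /path_distP[p [xp <- <-]].
have xE : last (last x p) (rev (belast x p)) = x.
  by case: p {xp} => //= z p; rewrite rev_cons last_rcons.
rewrite -{2}xE -(size_belast x p) -size_rev path_dist_le //.
by rewrite rev_path (eq_path (e' := e)) // => a b; exact: sym_e.
Qed.

Lemma path_dist_mem x p y : path e x p -> y \in x :: p ->
  path_dist e x y + path_dist e y (last x p) <= size p.
Proof.
move=> xp; rewrite inE => /orP[/eqP ->|yp].
  by rewrite path_dist_refl path_dist_le.
case/splitPr: yp xp => p1 p2; rewrite cat_path last_cat size_cat /=.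
move=> /and3P[xp1 p1y yp2].
have := path_dist_le yp2.
have : path e x (rcons p1 y) by rewrite rcons_path xp1.
move/path_dist_le; rewrite last_rcons size_rcons; lia.
Qed.

End Distance.

Section Trees.
Variables (T : eqType) (t : rel T).
Hypothesis tree_t : is_tree t.

(* A vertex m of p that is missed by q has two distinct neighbours on p, which
   p and q join off m; a simple such path closes up through m. *)
Lemma tree_separation a p q :
  path t a p -> uniq (a :: p) -> path t a q -> last a q = last a p ->
  {subset a :: p <= a :: q}.
Proof.
case: tree_t => sym_t _ _ acyclic_t ap Up aq qp m mp.
apply/negPn/negP => mq.
have m_p : m \in p.
  by move: mp; rewrite inE => /orP[/eqP ma|//]; rewrite ma mem_head in mq.
case/splitPr: m_p ap Up qp {mp} => p1 [|r p2].
  by rewrite last_cat /= => _ _ qm; rewrite -qm mem_last in mq.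
rewrite cat_path last_cat /= mem_cat !inE cat_uniq /=.
move=> /and4P[ap1 p1m mr rp2].
rewrite !negb_or -!andbA => /and5P[_ am ar _ /and5P[_ mp1 rp1 _]].
move=> /and4P[] mr' mp2 rp2' _ qp.
pose t' : rel T := fun x y => [&& t x y, x != m & y != m].
have sym_t' : symmetric t' by move=> x y; rewrite /t' sym_t [X in _ && X]andbC.
have off x s : path t x s -> m \notin x :: s -> joined t' x (last x s).
  move=> xs ms; exists s => //.
  apply: (sub_in_path (P := predC1 m)) xs.
    by by move=> y z; rewrite !inE /t' /= => -> -> ->.
  by apply/allP => y /=; apply: contraTneq => ->.
have /joined_sym : joined t' (last a p1) r.
  apply: (joined_trans (y := a)).
    apply: joined_sym => //; apply: off => //.
    by rewrite inE negb_or eq_sym am.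
  apply: (joined_trans (off _ _ aq mq)); rewrite qp.
  apply: joined_sym => //; apply: off => //.
  by rewrite inE negb_or mr'.
move=> /(_ sym_t')[c0]; case/shortenP => c rc Uc _ {c0}.
case: c rc Uc => [_ _ /= rE|s c rc Uc lE].
  by have := mem_last a p1; rewrite -rE inE eq_sym (negbTE ar) (negbTE rp1).
have path_off x l : path t' x l -> m \notin l.
  elim: l x => //= z l IH x /andP[/and3P[_ _ zm] /IH ml].
  by rewrite inE negb_or eq_sym zm.
have rc' : path t r (s :: c) by apply: sub_path rc => x y /and3P[].
have /acyclic_t : ucycle t (m :: r :: s :: c).
  apply/andP; split; last by rewrite cons_uniq Uc inE negb_or mr' (path_off r).
  by rewrite /cycle -/(path t) rcons_path [last _ _]lE p1m andbT /= mr.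
by [].
Qed.

(** Each edge is replaced by a tree geodesic of length at most [J], which stays within [J] of the
    image of the first end. *)
Lemma image_path (V : eqType) (e : rel V) (f : V -> T) J x p :
  (forall y y', e y y' -> path_dist t (f y) (f y') <= J) -> path e x p ->
  exists q, [/\ path t (f x) q, last (f x) q = f (last x p) &
    forall m, m \in f x :: q -> exists2 s, s \in x :: p & path_dist t (f s) m <= J].
Proof.
case: tree_t => _ _ conn _ Jf.
elim: p x => [|y p IH] x /=.
  move=> _; exists [::]; split=> // m; rewrite inE => /eqP ->.
  by exists x; rewrite ?mem_head ?path_dist_refl.
move=> /andP[xy /IH[q [yq qy near_q]]].
have [r [xr ry rE]] := path_distP (conn (f x) (f y)).
exists (r ++ q); rewrite cat_path last_cat ry xr yq qy; split=> // m.
rewrite -cat_cons mem_cat => /orP[mr|mq].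
  exists x; first exact: mem_head.
  by have := path_dist_mem xr mr; have := Jf _ _ xy; rewrite -rE; lia.
have /near_q[s sp sm] : m \in f y :: q by rewrite inE mq orbT.
by exists s => //; rewrite inE sp orbT.
Qed.

Lemma switch_point (P Q : T -> Prop) a p :
  path t a p -> (forall m, m \in a :: p -> P m \/ Q m) -> P a -> Q (last a p) ->
  exists m m', [/\ m \in a :: p, P m, Q m' & m = m' \/ t m m'].
Proof.
elim: p a => [|b p IH] a /=.
  by move=> _ _ Pa Qa; exists a, a; split; rewrite ?mem_head //; left.
move=> /andP[ab bp] PQ Pa Qp.
have [Pb|Qb] : P b \/ Q b by apply: PQ; rewrite !inE eqxx orbT.
  have [|m [m' [mp Pm Qm' mm']]] := IH b bp _ Pb Qp.
    by move=> m mp; apply: PQ; rewrite inE mp orbT.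
  by exists m, m'; split=> //; rewrite inE mp orbT.
by exists a, b; split=> //; [rewrite mem_head|right].
Qed.

Section Bottleneck.
Variables (V : eqType) (e : rel V) (f : V -> T) (J Q : nat).
Hypotheses (sym_e : symmetric e) (conn_e : forall x y, joined e x y).
Hypothesis fJ : forall x y, e x y -> path_dist t (f x) (f y) <= J.
Hypothesis fQ : forall x y,
  path_dist t (f x) (f y) <= J + J + 1 -> path_dist e x y <= Q.

(* The images of geodesics from o to x and from o to y cover the simple path of
   the tree from f x to f y, so somewhere on it one image takes over from the
   other; the image of p passes there too. *)
Lemma bottleneck o n x p :
  path e x p -> (forall s, s \in x :: p -> n <= path_dist e o s) ->
  path_dist e o x = n -> path_dist e o (last x p) = n ->
  path_dist e x (last x p) <= Q + Q + Q + Q.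
Proof.
case: (tree_t) => sym_t _ conn_t _.
set y := last x p => xp far xn yn.
have symd a b : path_dist t a b = path_dist t b a.
  exact: path_dist_sym.
have triT a b c : path_dist t a c <= path_dist t a b + path_dist t b c.
  by apply: path_dist_triangle; exact: conn_t.
have triV a b c : path_dist e a c <= path_dist e a b + path_dist e b c.
  exact: path_dist_triangle.
have symV a b : path_dist e a b = path_dist e b a by exact: path_dist_sym.
have [g1 [og1 g1x g1E]] := path_distP (conn_e o x).
have [g2 [og2 g2y g2E]] := path_distP (conn_e o y).
have [q [xq qy nearq]] := image_path fJ xp.
have [q1 [oq1 q1x near1]] := image_path fJ og1.
have [q2 [oq2 q2y near2]] := image_path fJ og2.
rewrite g1x in q1x; rewrite g2y in q2y; rewrite -/y in qy.
have simple : exists2 s, path t (f x) s & uniq (f x :: s) /\ last (f x) s = f y.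
  have [s0 xs0 <-] := conn_t (f x) (f y).
  by case/shortenP: xs0 => s xs Us _; exists s.
case: simple => s xs [Us sy].
have s_q : {subset f x :: s <= f x :: q}.
  by apply: tree_separation; rewrite // qy sy.
have s_q12 : {subset f x :: s <= f x :: rev (belast (f o) q1) ++ q2}.
  have rE : last (f x) (rev (belast (f o) q1)) = f o.
    by rewrite -q1x; case: (q1) => //= z l; rewrite rev_cons last_rcons.
  apply: tree_separation => //.
    rewrite cat_path rE oq2 andbT -q1x rev_path (eq_path (e' := t)) //.
  by rewrite last_cat rE q2y sy.
pose P m := m \in f o :: q1; pose P' m := m \in f o :: q2.
have [|||m [m' [ms Pm Pm' mm']]] := switch_point (P := P) (Q := P') xs.
- move=> m /s_q12; rewrite -cat_cons mem_cat => /orP[mq1|mq2].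
    left; rewrite /P lastI q1x mem_rcons; move: mq1.
    by rewrite !inE mem_rev.
  by right; rewrite /P' inE mq2 orbT.
- by rewrite /P -q1x mem_last.
- by rewrite /P' sy -q2y mem_last.
have [s0 s0p s0m] := nearq _ (s_q _ ms).
have [s1 s1p s1m] := near1 _ Pm.
have [s2 s2p s2m] := near2 _ Pm'.
have mm'1 : path_dist t m m' <= 1.
  case: mm' => [->|mm']; first by rewrite path_dist_refl.
  by have /= := @path_dist_le _ t m [:: m']; rewrite mm'; exact.
have d01 : path_dist e s0 s1 <= Q.
  apply: fQ; rewrite (leq_trans (triT _ m _)) // (symd m).
  by rewrite (leq_trans (leq_add s0m s1m)) ?leq_addr.
have d02 : path_dist e s0 s2 <= Q.
  apply: fQ; rewrite (leq_trans (triT _ m _)) // -addnA leq_add //.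
  by rewrite (leq_trans (triT _ m' _)) // addnC leq_add // symd.
have d1 := path_dist_mem og1 s1p; have d2 := path_dist_mem og2 s2p.
rewrite g1E xn g1x in d1; rewrite g2E yn g2y in d2.
(* [s0] has level at least [n] and [s1] lies on a geodesic of length [n] to [x], so [s1] is within
   [Q] of [x]; likewise [s2] and [y]. The four legs through [s1], [s0], [s2] add up to the bound. *)
have := far _ s0p; have := triV o s1 s0; have := triV o s2 s0.
have := triV x s1 y; have := triV s1 s0 y; have := triV s0 s2 y.
rewrite (symV s1 s0) (symV s2 s0) (symV x s1).
by move: d01 d02 d1 d2; clear; lia.
Qed.

End Bottleneck.
End Trees.

Section TreeLike.
Variables (K : realType) (V : eqType) (e : rel V).
Hypotheses (sym_e : symmetric e) (conn_e : forall x y, joined e x y).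
Import Order.TTheory GRing.Theory Num.Theory.
Local Open Scope ring_scope.

Lemma tree_like_bottleneck : tree_like K e ->
  exists D, forall o n x p,
    path e x p -> (forall s, s \in x :: p -> (n <= path_dist e o s)%N) ->
    path_dist e o x = n -> path_dist e o (last x p) = n ->
    (path_dist e x (last x p) <= D)%N.
Proof.
move=> [T [t [tree_t [f [k [eps [C [k1 eps0 _ qi _]]]]]]]].
have k0 : 0 < k by lra.
(* [J] comes from the upper quasi-isometry inequality for adjacent vertices, [Q] from the lower one
   for vertices with close images. *)
pose J := Num.bound (k + eps).
pose Q := Num.bound (k * ((J + J + 1)%:R + eps)).
exists (Q + Q + Q + Q)%N => o n x p.
apply: (bottleneck tree_t (f := f) (J := J)) => // {o n x p} x y.
  move=> xy; have [_ le] := qi x y.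
  have d1 : (path_dist e x y <= 1)%N.
    by have /= := @path_dist_le _ e x [:: y]; rewrite xy; exact.
  rewrite -(ler_nat K); apply: le_trans le _.
  apply: le_trans (ltW (archi_boundP _)); last by lra.
  rewrite lerD2r -[leRHS]mulr1 ler_pM2l //.
  by rewrite (ler_nat K _ 1).
move=> xy; have [le _] := qi x y.
rewrite -(ler_nat K).
apply: le_trans (ltW (archi_boundP _)); last first.
  by rewrite mulr_ge0 ?(ltW k0) // addr_ge0.
rewrite -ler_pdivrMl // mulrC.
have : (path_dist t (f x) (f y))%:R <= (J + J + 1)%:R :> K by rewrite ler_nat.
by rewrite mulrC; lra.
Qed.

End TreeLike.

(** * Gluing along a cut *)

Section Balls.
Variables (A : finType) (V : Type) (e : V -> letter A -> V -> Prop).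

Definition ball (v : V) (k : nat) (s : V) :=
  exists2 u, size u <= k & walk e v u s.

Lemma ball_center v k : ball v k v.
Proof. by exists [::]. Qed.

Lemma ball_le v k k' s : k <= k' -> ball v k s -> ball v k' s.
Proof. by move=> kk' [u uk vs]; exists u => //; exact: leq_trans uk kk'. Qed.

Lemma ball_walk v k s u t : ball v k s -> walk e s u t -> ball v (k + size u) t.
Proof.
move=> [h hk vs] st; exists (h ++ u); first by rewrite size_cat leq_add2r.
by apply/walk_cat; exists s.
Qed.

Lemma ball_edge v k s a t : ball v k s -> e s a t -> ball v k.+1 t.
Proof. by move=> vs /walk1 st; rewrite -addn1; exact: ball_walk vs st. Qed.

(** An isomorphism of balls matching [Y1] with [Y2], expressed by finite data on words; the case
    [u = u'] of the first clause is readability. *)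
Definition alike (r : nat) (v1 : V) (Y1 : V -> Prop) (v2 : V) (Y2 : V -> Prop) :=
  (forall u u', size u <= r -> size u' <= r ->
     (exists x, walk e v1 u x /\ walk e v1 u' x) <->
     (exists x, walk e v2 u x /\ walk e v2 u' x)) /\
  (forall u x1 x2, size u <= r -> walk e v1 u x1 -> walk e v2 u x2 ->
     (Y1 x1 <-> Y2 x2)).

Lemma alike_sym r v1 Y1 v2 Y2 :
  alike r v1 Y1 v2 Y2 -> alike r v2 Y2 v1 Y1.
Proof.
move=> [same side]; split=> [u u' ur u'r|u x1 x2 ur x1P x2P].
  by rewrite same.
by rewrite (side u x2 x1).
Qed.

Definition matched (r : nat) (v1 v2 s t : V) :=
  exists u, [/\ size u <= r, walk e v1 u s & walk e v2 u t].

Section Matching.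
Hypothesis det_e : deterministic e.
Variables (r : nat) (v1 v2 : V) (Y1 Y2 : V -> Prop).
Hypothesis sim : alike r.+1 v1 Y1 v2 Y2.

Lemma matched_fun s t t' :
  matched r v1 v2 s t -> matched r v1 v2 s t' -> t = t'.
Proof.
move=> [u [ur us ut]] [u' [u'r u's u't']].
have [|x [ux u'x]] := (sim.1 u u' (leqW ur) (leqW u'r)).1; first by exists s.
by rewrite (walk_det det_e ut ux) (walk_det det_e u't' u'x).
Qed.

Lemma matched_side s t : matched r v1 v2 s t -> Y1 s <-> Y2 t.
Proof. by move=> [u [ur us ut]]; apply: sim.2 us ut; exact: leqW. Qed.

(** [rcons u a] may have length [r.+1], whence that radius in [sim]. Comparing it with a short word
    [h] to [s'] keeps the matching at radius [r]. *)
Lemma matched_step s t a s' :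
  matched r v1 v2 s t -> e s a s' -> ball v1 r s' ->
  exists2 t', e t a t' & matched r v1 v2 s' t'.
Proof.
move=> [u [ur us ut]] ss' [h hr hs'].
have [||x [/walk_rcons[t0 t0P t0x] hx]] := (sim.1 (rcons u a) h _ (leqW hr)).1.
- by rewrite size_rcons.
- by exists s'; split=> //; apply/walk_rcons; exists s.
rewrite -(walk_det det_e ut t0P) in t0x.
by exists x => //; exists h.
Qed.

Lemma matched_ex s : ball v1 r s -> exists t, matched r v1 v2 s t.
Proof.
move=> [u ur us]; have [|t [ut _]] := (sim.1 u u (leqW ur) (leqW ur)).1.
  by exists s.
by exists t, u.
Qed.

End Matching.
End Balls.

(** The existence of a morphism to every such graph, in terms of words: path labels stay readable
    and equal end points stay equal. *)
Definition initial (A : finType) (R : seq (word A * word A)) (w : word A)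
    (V : Type) (e : V -> letter A -> V -> Prop) (o : V) :=
  forall (V' : Type) (e' : V' -> letter A -> V' -> Prop) (o' : V'),
  inverse_graph e' -> satisfies R e' -> (exists x, walk e' o' w x) ->
  (forall u y, walk e o u y -> exists x, walk e' o' u x) /\
  (forall u u' y x, walk e o u y -> walk e o u' y ->
     walk e' o' u x -> walk e' o' u' x).

Section Gluing.
Variables (A : finType) (R : seq (word A * word A)) (w : word A).
Variables (V : Type) (e : V -> letter A -> V -> Prop) (o : V).
Hypotheses (inv_e : inverse_graph e) (Re : satisfies R e).
Hypothesis init_e : initial R w e o.
Variables (N D : nat).
Hypothesis short : forall u v, (u, v) \in R -> size u <= N /\ size v <= N.

(** The inner boundary is close to [v]; [w] is read before the cut, so that initiality applies after
    regluing; and some path from [o] first meets [Y] at [v]. *)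
Definition cut (v : V) (Y : V -> Prop) :=
  [/\ Y v,
      forall s a t, e s a t -> Y s -> ~ Y t -> ball e v D s,
      exists x, walk (within e (fun s => ~ Y s)) o w x &
      exists g a x, [/\ walk (within e (fun s => ~ Y s)) o g x, ~ Y x & e x a v]].

(** [D.+1] covers both ends of the edges of the cut, one [N] the starting points of relators that
    may meet it, the other [N] the reading of such a relator. *)
Local Notation r := (D.+1 + N + N).

Section Glued.
Variables (v1 v2 : V) (Y1 Y2 : V -> Prop).
Hypotheses (cut1 : cut v1 Y1) (sim : alike e r.+1 v1 Y1 v2 Y2).
Local Notation M := (matched e r v1 v2).
Let det := inv_e.1.

Definition crossing (s t : V) := ~ (Y1 s <-> Y1 t).

Definition aligned (p : V * option V) :=
  if p.2 is Some t then M p.1 t else True.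

Definition lifted (a : letter A) (i j : option V) :=
  match i, j with
  | None, None => True
  | Some t, Some t' => e t a t'
  | _, _ => False
  end.

(* The states (s, None) form a copy of the graph and the states (s, Some t) a copy
   of its square. Both copies are cut along the edges over which Y1 changes, in
   the square only at matched pairs, and are reconnected crosswise there. *)
Definition glue (p : V * option V) (a : letter A) (q : V * option V) :=
  e p.1 a q.1 /\
  ([/\ crossing p.1 q.1, aligned p, aligned q & isSome p.2 = ~~ isSome q.2] \/
   ~ (crossing p.1 q.1 /\ aligned p) /\ lifted a p.2 q.2).

Lemma crossing_sym s t : crossing s t -> crossing t s.
Proof. by move=> st ts; apply: st; rewrite ts. Qed.

Lemma crossing_ball s a t : e s a t -> crossing s t -> ball e v1 D.+1 s.
Proof.
case: cut1 => _ bd _ _ st.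
case: (pselect (Y1 s)) => [Ys|nYs]; case: (pselect (Y1 t)) => [Yt|nYt].
- by case; split.
- by move=> _; apply: ball_le (bd _ _ _ st Ys nYt).
- move/inv_e.2: st => ts _; exact: ball_edge (bd _ _ _ ts Yt nYs) ts.
- by case; split.
Qed.

Lemma lifted_sym a i j : lifted a i j -> lifted (invl a) j i.
Proof. by case: i j => [t|] [t'|] //=; exact: inv_e.2. Qed.

Lemma aligned_lift p a q :
  e p.1 a q.1 -> lifted a p.2 q.2 -> aligned p -> ball e v1 r q.1 -> aligned q.
Proof.
case: p q => [s [t|]] [s' [t'|]] //=; rewrite /aligned /= => ss' tt' st bs'.
have [t'' tt'' ?] := matched_step det sim st ss' bs'.
by rewrite (det tt' tt'').
Qed.

Lemma glue_inverse : inverse_graph glue.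
Proof.
split=> [[s i] a [s1 j1] [s2 j2] [/= ss1 E1] [/= ss2]|].
  rewrite -(det ss1 ss2) => {ss2 s2} E2; congr (_, _).
  case: E1 E2 => [[c al al1 sw1]|[ncal l1]] [[c' al' al2 sw2]|[ncal' l2]].
  - case: j1 al1 sw1 => [t1|]; case: j2 al2 sw2 => [t2|] //=.
    + by move=> m2 _ m1 _; rewrite (matched_fun det sim m1 m2).
    + by move=> _ sw2 _; rewrite sw2.
    + by move=> _ sw2 _; rewrite sw2.
  - by case: ncal'.
  - by case: ncal.
  - case: i j1 j2 l1 l2 {ncal ncal'} => [t|] [t1|] [t2|] //= tt1 tt2.
    by rewrite (det tt1 tt2).
move=> [s i] a [s' j] [/= ss' E]; split=> /=; first exact: inv_e.2.
case: E => [[c al al' sw]|[ncal l]]; [left|right].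
  split=> //; first exact: crossing_sym.
  by rewrite sw negbK.
split; last exact: lifted_sym.
(* The second case of [glue] tests alignment at the source only. For the reversed edge it is
   transported to the other end, which lies in the ball because the edge crosses. *)
move=> [/crossing_sym c al']; apply: ncal; split=> //.
apply: (@aligned_lift (s', j) (invl a)) => //=; first exact: inv_e.2.
  exact: lifted_sym.
apply: ball_le (crossing_ball ss' c); lia.
Qed.

(* Over the matched balls the glued graph consists of two copies of the ball of
   v1; [b] tells them apart. *)
Definition sheet (b : bool) (p : V * option V) :=
  if p.2 is Some t then (Y1 p.1 <-> ~~ b) /\ M p.1 t else Y1 p.1 <-> b.

Lemma sheet_aligned p : aligned p -> exists b, sheet b p.
Proof.
case: p => s [t|]; rewrite /aligned /sheet /=; case: (pselect (Y1 s)) => Ys.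
- by exists false; split=> //; split.
- by exists true; split=> //; split.
- by exists true; split.
- by exists false; split.
Qed.

Lemma aligned_sheet b p : sheet b p -> aligned p.
Proof. by case: p => s [t|] //= []. Qed.

Lemma iff_negb (P : Prop) (b : bool) : (P <-> b) -> (P <-> ~~ b) -> False.
Proof.
by case: b => /= -[h1 h2] [h3 h4]; [have := h3 (h2 isT)|have := h1 (h4 isT)].
Qed.

Lemma sheet_fun b s i j : sheet b (s, i) -> sheet b (s, j) -> i = j.
Proof.
case: i j => [t|] [t'|] //=; rewrite /sheet /=.
- by move=> [_ m] [_ m']; rewrite (matched_fun det sim m m').
- by move=> [h _] h'; case: (iff_negb h' h).
- by move=> h' [h _]; case: (iff_negb h' h).
Qed.

Lemma sheet_ex b s : ball e v1 r s -> exists i, sheet b (s, i).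
Proof.
move=> /(matched_ex sim)[t st].
case: (pselect (Y1 s <-> b)) => Ys; first by exists None.
exists (Some t); split=> //=; case: b Ys => /= nYs.
  by split=> // Yt; case: nYs.
by split=> // _; apply: contrapT => nY; apply: nYs; split.
Qed.

(** A crossing changes both [Y1] and the copy, any other step neither, so [b] is preserved. *)
Lemma sheet_step b p a s : sheet b p -> e p.1 a s -> ball e v1 r s ->
  exists2 i, sheet b (s, i) & glue p a (s, i).
Proof.
move=> bp ps bs; have [i bi] := sheet_ex b bs; exists i => //.
split=> //=; have al := aligned_sheet bp; have ali := aligned_sheet bi.
case: (pselect (crossing p.1 s)) => c; [left|right].
  split=> //; case: p c bp {al ps} => s0 [t|]; case: i bi {ali} => [t'|];
    rewrite /sheet /crossing /= => h1 c h2 //; exfalso; tauto.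
split; first by case.
move/contrapT: c => c.
case: p c bp al ps => s0 [t|] /=; case: i bi ali => [t'|] //=;
  rewrite /sheet /=.
- move=> _ st' _ _ st0 s0s; have [t'' tt'' st''] := matched_step det sim st0 s0s bs.
  by rewrite (matched_fun det sim st' st'').
- by move=> h _ c [h' _] _ _; apply: (iff_negb h); rewrite -c.
- by move=> [h _] _ c h' _ _; apply: (iff_negb h'); rewrite c.
Qed.

Lemma sheet_walk b k p u s : sheet b p -> ball e v1 k p.1 -> k + size u <= r ->
  walk e p.1 u s -> exists2 i, sheet b (s, i) & walk glue p u (s, i).
Proof.
elim: u k p => [|a u IH] k [s0 i0] bp bk /=.
  by move=> _ <-; exists i0.
move=> kr [z [sz zs]]; have bz := ball_edge bk sz.
have [|i bi gi] := sheet_step bp sz; first by apply: ball_le bz; lia.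
have [|i' bi' gi'] := IH _ _ bi bz _ zs; first by rewrite addSnnS.
by exists i' => //; exists (z, i).
Qed.

(** The disjoint union of the graph and its square, before cutting and regluing. *)
Definition product (p : V * option V) (a : letter A) (q : V * option V) :=
  e p.1 a q.1 /\ lifted a p.2 q.2.

Lemma product_walk p u q :
  walk product p u q <->
  walk e p.1 u q.1 /\
  match p.2, q.2 with
  | None, None => True
  | Some t, Some t' => walk e t u t'
  | _, _ => False
  end.
Proof.
elim: u p q => [|a u IH] [s i] [s' i'] /=.
  split=> [[-> ->]|]; first by case: i'.
  by case: i i' => [t|] [t'|] [-> //]; move=> ->.
split=> [[[z j] [[/= sz l] /IH[/= zs jP]]]|[[z [sz zs]]]].
  split; first by exists z.
  case: i j i' l jP => [t|] [t'|] [t''|] //= tt' t't''.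
  by exists t'.
case: i i' => [t|] [t'|] //.
  move=> [t0 [tt0 t0t']]; exists (z, Some t0); split=> //.
  exact/IH.
move=> _; exists (z, None); split=> //.
exact/IH.
Qed.

Definition near k p := aligned p /\ ball e v1 (D.+1 + k) p.1.

Lemma far_edge p a q : ~ near 0 p -> glue p a q <-> product p a q.
Proof.
move=> far; split=> [[pq [[c al _ _]|[_ l]]]|[pq l]].
- by case: far; split=> //; rewrite addn0; exact: crossing_ball pq c.
- by [].
- split=> //; right; split=> // -[c al].
  by case: far; split=> //; rewrite addn0; exact: crossing_ball pq c.
Qed.

Lemma near_back k p a q : k < N -> product p a q -> near k q -> near k.+1 p.
Proof.
move=> kN [pq l] [al bq]; move/inv_e.2: pq => qp.
have bp := ball_edge bq qp; split; last by rewrite addnS.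
apply: aligned_lift qp (lifted_sym l) al _.
apply: ball_le bp; lia.
Qed.

(** Only edges starting in [near 0] are altered, and by [near_back] these are out of reach. *)
Lemma far_walk k p u q : k <= N -> size u <= k -> ~ near k p ->
  walk glue p u q <-> walk product p u q.
Proof.
elim: u k p => [|a u IH] [|k] p //= kN uk far.
have far0 : ~ near 0 p.
  by move=> [al bp]; apply: far; split=> //; apply: ball_le bp; lia.
have IHz z : product p a z -> walk glue z u q <-> walk product z u q.
  by move=> pz; apply: (IH k) => // [|/(near_back kN pz)//]; exact: ltnW.
split=> -[z [pz zq]]; exists z.
  by move/(far_edge _ _ far0): pz => pz; split=> //; apply: (IHz z pz).1.
by split; [apply/(far_edge _ _ far0)|apply: (IHz z pz).2].
Qed.

(** Away from the cut a relator is read in the product, where [R] holds in each coordinate. Near it,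
    the relator stays in one sheet, which has at most one vertex over each vertex of the ball. *)
Lemma glue_satisfies : satisfies R glue.
Proof.
suff half u v p q : size u <= N -> size v <= N ->
    (forall x y, walk e x u y <-> walk e x v y) ->
    walk glue p u q -> walk glue p v q.
  move=> u v uv p q; have [uN vN] := short uv.
  by split; apply: half => // x y; have := Re uv x y; tauto.
move=> uN vN uv pq.
case: (pselect (near N p)) => [[al bp]|far]; last first.
  apply/(far_walk _ (leqnn N) vN far).
  move/(far_walk _ (leqnn N) uN far): pq => /product_walk[pq l].
  apply/product_walk; split.
    exact/uv.
  by case: (p.2) (q.2) l => [t|] [t'|] // /uv.
have [b bP] := sheet_aligned al.
have pq1 : walk e p.1 u q.1.
  elim: (u) (p) pq => [|a u' IH] p' /=; first by move=> ->.
  by move=> [z [[p'z _] /IH zq]]; exists z.1.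
have [|i bi gi] := sheet_walk bP bp _ pq1; first by lia.
have [|j bj gj] := sheet_walk bP bp _ ((uv _ _).1 pq1); first by lia.
rewrite (sheet_fun bj bi) in gj.
by rewrite (walk_det glue_inverse.1 pq gi).
Qed.

Lemma outside_walk s u x :
  walk (within e (fun s => ~ Y1 s)) s u x -> walk glue (s, None) u (x, None).
Proof.
elim: u s => [|a u IH] s /=; first by move=> ->.
move=> [z [[Ys Yz sz] /IH zx]]; exists (z, None); split=> //.
by split=> //; right; split=> // -[c _]; apply: c; split.
Qed.

Lemma inside_walk s t u x q :
  walk (within e Y1) s u x -> walk glue (s, Some t) u q ->
  exists2 t', q = (x, Some t') & walk e t u t'.
Proof.
elim: u s t => [|a u IH] s t /=; first by move=> -> <-; exists t.
move=> [z [[Ys Yz sz] zx]] [[z' i] [[/= sz' E] gq]].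
rewrite -(det sz sz') in E gq.
case: E => [[c _ _ _]|[_]]; first by case: c; split.
case: i gq => [t0|] //= gq tt0.
have [t' qE t0t'] := IH _ _ zx gq.
by exists t' => //; exists t0.
Qed.

Lemma matched_roots : M v1 v2.
Proof. by exists [::]. Qed.

(** The last edge of the path to [v1] given by [cut] crosses, and [v1] is matched with [v2], so the
    walk switches to the square there. *)
Lemma enter_walk :
  exists g, walk e o g v1 /\ walk glue (o, None) g (v1, Some v2).
Proof.
case: cut1 => Yv1 _ _ [g [a [x [og nYx xv1]]]].
exists (rcons g a); split; apply/walk_rcons.
  by exists x => //; exact: walk_within og.
exists (x, None); first exact: outside_walk.
split=> //; left; split=> //; last exact: matched_roots.
by move=> [_ /(_ Yv1)].
Qed.

Lemma initial_glue :
  (forall u y, walk e o u y -> exists q, walk glue (o, None) u q) /\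
  (forall u u' y q, walk e o u y -> walk e o u' y ->
     walk glue (o, None) u q -> walk glue (o, None) u' q).
Proof.
apply: init_e; [exact: glue_inverse|exact: glue_satisfies|].
by case: cut1 => _ _ [x ox] _; exists (x, None); exact: outside_walk.
Qed.

Lemma glued_readable z x : walk e v1 z x -> exists q, walk glue (v1, Some v2) z q.
Proof.
move=> v1x; have [g [ov1 gv1]] := enter_walk.
have [|q /walk_cat[p gp pq]] := initial_glue.1 (g ++ z) x.
  by apply/walk_cat; exists v1.
by exists q; rewrite (walk_det glue_inverse.1 gv1 gp).
Qed.

Lemma glued_eq z z' x q : walk e v1 z x -> walk e v1 z' x ->
  walk glue (v1, Some v2) z q -> walk glue (v1, Some v2) z' q.
Proof.
move=> v1x v1x' gz; have [g [ov1 gv1]] := enter_walk.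
have /walk_cat[p gp pq] : walk glue (o, None) (g ++ z') q.
  apply: (initial_glue.2 (g ++ z) (g ++ z') x).
  - by apply/walk_cat; exists v1.
  - by apply/walk_cat; exists v1.
  - by apply/walk_cat; exists (v1, Some v2).
by rewrite (walk_det glue_inverse.1 gv1 gp).
Qed.

Lemma inside_readable z x : walk (within e Y1) v1 z x -> exists t, walk e v2 z t.
Proof.
move=> v1x; have [q gq] := glued_readable (walk_within v1x).
by have [t _ v2t] := inside_walk v1x gq; exists t.
Qed.

Lemma inside_eq z z' x t :
  walk (within e Y1) v1 z x -> walk (within e Y1) v1 z' x ->
  walk e v2 z t -> walk e v2 z' t.
Proof.
move=> v1x v1x'; have [q gq] := glued_readable (walk_within v1x).
have gq' := glued_eq (walk_within v1x) (walk_within v1x') gq.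
have [t0 qE v2t0] := inside_walk v1x gq.
have [t0' + v2t0'] := inside_walk v1x' gq'.
by rewrite qE => -[E] /(walk_det det v2t0) <-; rewrite E.
Qed.

(** However long [z] is, by [glued_eq] it ends in the glued graph where a short word [h] to [x]
    ends, and [h] stays in the sheet of [(v1, Some v2)]. *)
Lemma inside_matched z x t : walk (within e Y1) v1 z x -> ball e v1 r x ->
  walk e v2 z t -> M x t.
Proof.
move=> v1x [h hr hx] v2t.
have [q gq] := glued_readable (walk_within v1x).
have [t0 qE v2t0] := inside_walk v1x gq.
rewrite -(walk_det det v2t v2t0) in qE.
have gq' := glued_eq (walk_within v1x) hx gq.
have Yv1 : Y1 v1 by case: cut1.
have sv1 : sheet false (v1, Some v2) by split; [split|exact: matched_roots].
have [i ix gi] := sheet_walk (k := 0) sv1 (ball_center _ _ _) hr hx.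
move: ix; have := walk_det glue_inverse.1 gq' gi; rewrite qE => -[<-].
by case.
Qed.

End Glued.
(** If the last letter left [Y2], it would do so near [v2], at a vertex matched with the current one
    in [Y1]; the matching would then carry the exit back to an exit from [Y1]. *)
Lemma inside_transfer v1 v2 Y1 Y2 z x :
  cut v1 Y1 -> cut v2 Y2 -> alike e r.+1 v1 Y1 v2 Y2 ->
  walk (within e Y1) v1 z x -> exists t, walk (within e Y2) v2 z t.
Proof.
move=> cut1 cut2 sim; have sim' := alike_sym sim.
elim/last_ind: z x => [|z a IH] x; first by exists v2.
move=> v1x; have [t /walk_rcons[t' v2t' t't]] := inside_readable cut1 sim v1x.
case/walk_rcons: v1x => x' v1x' [Yx' Yx x'x].
have [t'' v2t''] := IH _ v1x'.
have t'E := walk_det inv_e.1 v2t' (walk_within v2t'').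
rewrite -t'E in v2t'' => {t'' t'E}.
have Yt' : Y2 t' by apply: within_end v2t''; case: cut2.
exists t; apply/walk_rcons; exists t' => //; split=> //.
apply: contrapT => nYt.
have bt' : ball e v2 D t' by case: cut2 => _ bd _ _; exact: bd t't Yt' nYt.
have t'x' : matched e r v2 v1 t' x'.
  apply: (inside_matched cut2 sim') v2t'' _ (walk_within v1x').
  apply: ball_le bt'; lia.
have [|x0 x'x0 tx0] := matched_step inv_e.1 sim' t'x' t't.
  apply: ball_le (ball_edge bt' t't); lia.
apply/nYt/(matched_side sim' tx0).
by rewrite (inv_e.1 _ _ _ _ x'x0 x'x).
Qed.

End Gluing.

(** * Cones *)

Section Cones.
Variables (A : finType) (R : seq (word A * word A)) (w : word A).
Variables (V : Type) (e : V -> letter A -> V -> Prop) (o : V).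
Hypotheses (inv_e : inverse_graph e) (Re : satisfies R e).
Hypotheses (init_e : initial R w e o) (w_o : exists x, walk e o w x).
Variables (N D : nat).
Hypothesis short : forall u v, (u, v) \in R -> size u <= N /\ size v <= N.
Variable d : V -> nat.
Hypothesis d_le : forall u x, walk e o u x -> d x <= size u.
Hypothesis d_ex : forall x, exists2 u, walk e o u x & size u = d x.
Hypothesis narrow : forall x y u, d x = d y ->
  walk (within e (fun s => d x <= d s)) x u y -> ball e x D y.

Definition beyond (v s : V) :=
  exists u, walk (within e (fun s => d v <= d s)) v u s.

Definition cone (v : V) (z : word A) :=
  exists2 x, walk e v z x & d x = d v + size z.

Lemma d_walk x u y : walk e x u y -> d y <= d x + size u.
Proof.
have [g og <-] := d_ex x => xy; rewrite -size_cat; apply: d_le.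
by apply/walk_cat; exists x.
Qed.

Lemma d_edge x a y : e x a y -> d y <= (d x).+1.
Proof. by move/walk1/d_walk; rewrite addn1. Qed.

Lemma beyond_refl v : beyond v v.
Proof. by exists [::]. Qed.

Lemma beyond_ge v s : beyond v s -> d v <= d s.
Proof. by move=> [u]; apply: within_end. Qed.

Lemma beyond_step v s a t : beyond v s -> e s a t -> d v <= d t -> beyond v t.
Proof.
move=> vs st dt; have ds := beyond_ge vs; case: vs => u vs.
by exists (rcons u a); apply/walk_rcons; exists s.
Qed.

Lemma beyond_within v u s :
  walk (within e (fun s => d v <= d s)) v u s -> walk (within e (beyond v)) v u s.
Proof.
elim/last_ind: u s => [|u a IH] s // /walk_rcons[t vt ts].
apply/walk_rcons; exists t; first exact: IH.
by split; [exists u|exists (rcons u a); apply/walk_rcons; exists t|case: ts].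
Qed.

(** Distances change by at most one along an edge. So the inner boundary lies at the level of [v],
    where [narrow] applies. *)
Lemma beyond_boundary v s a t :
  e s a t -> beyond v s -> ~ beyond v t -> d s = d v.
Proof.
move=> st vs nvt; have ds := beyond_ge vs.
have dt : d t < d v.
  by rewrite ltnNge; apply/negP => /(beyond_step vs st).
have := d_edge (inv_e.2 _ _ _ st); lia.
Qed.

Lemma short_walk n u x : size u < n -> walk e o u x ->
  walk (within e (fun s => d s < n)) o u x.
Proof.
elim/last_ind: u x => [|u a IH] x // un /walk_rcons[t ot tx].
rewrite size_rcons in un; apply/walk_rcons; exists t.
  by apply: IH ot; exact: ltnW.
split=> //; first by have := d_le ot; lia.
by have := d_le ot; have := d_edge tx; lia.
Qed.

Lemma closer_not_beyond v s : d s < d v -> ~ beyond v s.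
Proof. by rewrite ltnNge => /negP h /beyond_ge. Qed.

(** Words shorter than [d v] only visit vertices closer to [o] than [v]. This applies to [w] and to
    a geodesic to [v] without its last letter. *)
Lemma cut_beyond v : size w < d v -> cut w e o D v (beyond v).
Proof.
move=> wv.
have outside u x : size u < d v -> walk e o u x ->
    walk (within e (fun s => ~ beyond v s)) o u x.
  move=> uv /(short_walk uv); apply: walk_sub => s a t [sv tv st].
  by split=> //; exact: closer_not_beyond.
split.
- exact: beyond_refl.
- move=> s a t st vs nvt; have ds := beyond_boundary st vs nvt.
  by case: vs => u /narrow; exact.
- by have [x ox] := w_o; exists x; exact: outside.
have [g ov gE] := d_ex v; case/lastP: g gE ov => [|g a].
  by move=> /= v0; rewrite -v0 in wv.
rewrite size_rcons => gE /walk_rcons[x ox xv]; exists g, a, x; split=> //.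
  by apply: outside; rewrite // -gE.
by apply: closer_not_beyond; have := d_le ox; rewrite -gE.
Qed.

Lemma cone_beyond v z x :
  walk e v z x -> d x = d v + size z -> walk (within e (beyond v)) v z x.
Proof.
elim/last_ind: z x => [|z a IH] x // /walk_rcons[y vy yx].
rewrite size_rcons => dx; have dy : d y = d v + size z.
  by have := d_edge yx; have := d_walk vy; lia.
have vyY := IH _ vy dy.
have Yy := within_end (beyond_refl v) vyY.
apply/walk_rcons; exists y => //; split=> //.
by apply: beyond_step Yy yx _; lia.
Qed.

Local Notation r := (D.+1 + N + N).

(** By [inside_transfer], [z] leads from [v2] to some [t] with [d t] at most [d v2 + size z].
    Conversely, a geodesic to [t] passes a boundary vertex [f] of level [d v2], matched with some
    [f'] of level [d v1]; its remainder leads from [f'] to [x], so has length at least [size z]. *)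
Lemma cone_sub v1 v2 z : size w < d v1 -> size w < d v2 ->
  alike e r.+1 v1 (beyond v1) v2 (beyond v2) -> cone v1 z -> cone v2 z.
Proof.
move=> wv1 wv2 sim [x v1x dx]; have sim' := alike_sym sim.
have cut1 := cut_beyond wv1; have cut2 := cut_beyond wv2.
have zY1 := cone_beyond v1x dx.
have [t zY2] := inside_transfer inv_e Re init_e short cut1 cut2 sim zY1.
exists t; first exact: walk_within zY2.
apply/eqP; rewrite eqn_leq (d_walk (walk_within zY2)) /=.
have Y2t := within_end (beyond_refl v2) zY2.
have [u ot uE] := d_ex t.
have ge := beyond_ge Y2t.
have u1E : size (take (d v2) u) = d v2 by rewrite size_takel // uE.
have u2E : size (drop (d v2) u) = d t - d v2 by rewrite size_drop uE.
move: ot; rewrite -(cat_take_drop (d v2) u) => /walk_cat[f of_ ft].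
have df : d f = d v2.
  by have := d_le of_; have := d_walk ft; lia.
have ft_far : walk (within e (fun s => d v2 <= d s)) f (drop (d v2) u) t.
  have : walk (within e (beyond f)) f (drop (d v2) u) t.
    by apply: cone_beyond ft _; lia.
  rewrite -df; apply: walk_sub => s a s' [sf s'f ss'].
  by split=> //; exact: beyond_ge.
have [h v2t] := Y2t.
set P := (fun s => d v2 <= d s) in v2t ft_far.
have tf := walkV (within_inverse inv_e P) ft_far.
(* Going to [t] and back along the geodesic shows that [f] lies in [beyond v2]. *)
have v2f : walk (within e P) v2 (h ++ invw (drop (d v2) u)) f.
  by apply/walk_cat; exists t.
set h' := h ++ _ in v2f.
have v2t' : walk (within e P) v2 (h' ++ drop (d v2) u) t.
  by apply/walk_cat; exists f.
have v2f_Y := beyond_within v2f; have v2t_Y := beyond_within v2t'.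
have [f' v1f'] := inside_transfer inv_e Re init_e short cut2 cut1 sim' v2f_Y.
have := inside_eq inv_e Re init_e short cut2 sim' zY2 v2t_Y v1x.
move=> /walk_cat[f'' v1f'' f'x].
rewrite -(walk_det inv_e.1 (walk_within v1f') v1f'') {f'' v1f''} in f'x.
suff df' : d f' = d v1.
  by have := d_walk f'x; rewrite u2E dx df' leq_add2l leq_subRL.
(* The geodesic enters [f] from a vertex closer to [o], so [f] is a boundary vertex within [D] of
   [v2]; the matching makes [f'] a boundary vertex for [v1]. *)
have [p [a [pf np]]] : exists p a, e p a f /\ ~ beyond v2 p.
  case/lastP: (take _ _) u1E of_ => [/= v20|g a].
    by rewrite -v20 in wv2.
  rewrite size_rcons => gE /walk_rcons[p op pf]; exists p, a; split=> //.
  by apply: closer_not_beyond; have := d_le op; lia.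
have fp := inv_e.2 _ _ _ pf.
have bf : ball e v2 D f.
  case: cut2 => _ bd _ _; apply: bd fp _ np.
  exact: within_end (beyond_refl v2) v2f_Y.
have ff' : matched e r v2 v1 f f'.
  apply: (inside_matched inv_e Re init_e short cut2 sim') v2f_Y _ (walk_within v1f').
  by apply: ball_le bf; lia.
have [|p' f'p' pp'] := matched_step inv_e.1 sim' ff' fp.
  by apply: ball_le (ball_edge bf fp); lia.
apply: (beyond_boundary f'p'); first exact: within_end (beyond_refl v1) v1f'.
by move/(matched_side sim' pp').
Qed.

End Cones.

(** * The Myhill-Nerode criterion *)

Section MyhillNerode.
Variables (L Q : finType) (X : set (seq L)) (c : seq L -> Q).
Hypothesis congr_c : forall u v z, c u = c v -> X (u ++ z) -> X (v ++ z).

(** Only membership in [X], not [c] itself, is assumed compatible with appending words; so the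
    automaton is nondeterministic, with a transition for every witness. *)
Lemma finite_index_rational : rational_language X.
Proof.
pose N := @Automaton L Q [set c [::]]%SET
  [set q : Q | `[< exists2 u, c u = q & X u >]]%SET
  (fun q a q' => `[< exists2 u, c u = q & c (rcons u a) = q' >]).
exists N; apply/seteqP; split=> u.
  move=> Xu; exists (c [::]), (c u); split.
  - by rewrite inE.
  - by rewrite inE; apply/asboolP; exists u.
  elim/last_ind: u {Xu} => [|u a IH] //.
  by apply/walk_rcons; exists (c u) => //; apply/asboolP; exists u.
move=> [i [f [iN fN iu]]].
have iE : i = c [::] by apply/set1P.
have [v vf Xv] : exists2 v, c v = f & X v by apply/asboolP; move: fN; rewrite inE.
(* The arbitrary suffix [z] absorbs the letters of [u] one by one from the right, while [v] changes
   to another witness. *)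
suff ext z : X (v ++ z) -> X (u ++ z).
  by have := ext [::]; rewrite !cats0; exact.
rewrite iE in iu; elim/last_ind: u f z iu v vf {fN Xv} => [|u a IH] f z.
  by move=> /= <- v vf; exact: congr_c vf.
move=> /walk_rcons[q iq /asboolP[t tq ta]] v vf vz.
rewrite cat_rcons; apply: (IH q _ iq t tq).
by rewrite -cat_rcons; apply: congr_c vz; rewrite vf.
Qed.

End MyhillNerode.

(** * Rationality of the geodesic language *)

Section RationalGeodesics.
Variables (A : finType) (R : seq (word A * word A)) (w : word A).
Variables (V : Type) (e : V -> letter A -> V -> Prop) (o : V).
Hypotheses (inv_e : inverse_graph e) (Re : satisfies R e).
Hypotheses (init_e : initial R w e o) (w_o : exists x, walk e o w x).
Variables (N D : nat).
Hypothesis short : forall u v, (u, v) \in R -> size u <= N /\ size v <= N.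
Variable d : V -> nat.
Hypothesis d_le : forall u x, walk e o u x -> d x <= size u.
Hypothesis d_ex : forall x, exists2 u, walk e o u x & size u = d x.
Hypothesis narrow : forall x y u, d x = d y ->
  walk (within e (fun s => d x <= d s)) x u y -> ball e x D y.

Definition geodesics : set (word A) :=
  [set u | exists2 x, walk e o u x & d x = size u]%classic.

(** Prefixes of geodesics are geodesics by the triangle inequality, so the possible extensions of
    [u] depend only on the cone of its end point. *)
Lemma geodesics_cat u z : geodesics (u ++ z) <->
  exists x, [/\ walk e o u x, d x = size u & cone e d x z].
Proof.
split=> [[y /walk_cat[x ox xy] dy]|[x [ox dx [y xy dy]]]].
  have dx : d x = size u.
    have := d_le ox; have := d_walk d_le d_ex xy; rewrite dy size_cat; lia.
  by exists x; split=> //; exists y => //; rewrite dy size_cat dx.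
exists y; first by apply/walk_cat; exists x.
by rewrite dy dx size_cat.
Qed.

Local Notation r := (D.+1 + N + N).+1.
Local Notation B := (r.-bseq (letter A)).

(** Bounded sequences form a finite type, so there are finitely many profiles. *)
Definition profile (v : V) : {set B * B} * {set B} :=
  (finset (fun p : B * B => `[< exists x, walk e v p.1 x /\ walk e v p.2 x >]),
   finset (fun u : B => `[< exists2 x, walk e v u x & beyond e d v x >])).

Lemma eq_profile v1 v2 : profile v1 = profile v2 ->
  alike e r v1 (beyond e d v1) v2 (beyond e d v2).
Proof.
move=> [/setP same /setP side]; split=> [u u' ur u'r|u x1 x2 ur v1x v2x].
  have := same (Bseq ur, Bseq u'r); rewrite !inE => E.
  by split=> h; apply/asboolP; [rewrite -E|rewrite E]; apply/asboolP.
have := side (Bseq ur); rewrite !inE => E; split=> h.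
  have : `[< exists2 x, walk e v1 u x & beyond e d v1 x >].
    by apply/asboolP; exists x1.
  by rewrite E => /asboolP[x /(walk_det inv_e.1 v2x) <-].
have : `[< exists2 x, walk e v2 u x & beyond e d v2 x >].
  by apply/asboolP; exists x2.
by rewrite -E => /asboolP[x /(walk_det inv_e.1 v1x) <-].
Qed.

(* [cone_sub] needs v to be so far from o that w is read before the cut, whence
   the separate treatment of short words. *)
Definition class (u : word A) :
    option ((size w).-bseq (letter A) + {set B * B} * {set B}) :=
  if pselect (geodesics u) is left h then
    Some (if size u <= size w then inl (insub_bseq (size w) u)
          else inr (profile (s2val (cid2 h))))
  else None.

Lemma class_congr u v z :
  class u = class v -> geodesics (u ++ z) -> geodesics (v ++ z).
Proof.
move=> uv /geodesics_cat[x [ox dx xz]]; apply/geodesics_cat.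
move: uv; rewrite /class; case: pselect => [hu|[]]; last by exists x.
case: pselect => // hv.
case: ifPn => [uw|wu]; case: ifPn => [vw|wv] //.
  move=> [/(congr1 val)]; rewrite /insub_bseq !val_insubd uw vw => uv.
  by exists x; rewrite -uv.
(* The default [profile o] merely makes the projection total. *)
move=> /(congr1 (fun q => if q is Some (inr t) then t else profile o)) /=.
case: (cid2 hu) => /= x' ox' dx'; case: (cid2 hv) => /= y oy dy.
rewrite -(walk_det inv_e.1 ox ox') {ox' dx'} => /eq_profile xy; exists y.
split=> //; apply: (cone_sub inv_e Re init_e w_o short d_le d_ex narrow) xy xz.
  by rewrite dx ltnNge.
by rewrite dy ltnNge.
Qed.

Lemma geodesics_rational : rational_language geodesics.
Proof. exact: finite_index_rational class_congr. Qed.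

End RationalGeodesics.

Section Adjacency.
Variables (L : Type) (G : lgraph L).
Local Notation edge := (@ledge L G).

Lemma walk_path P x u y : walk (within edge P) x u y ->
  exists p, [/\ path (adj (G := G)) x p, last x p = y, size p = size u &
    forall s, s \in p -> P s].
Proof.
elim: u x => [|a u IH] x /=; first by move=> <-; exists [::].
move=> [z [[_ Pz xz] /IH[p [zp py pu Pp]]]]; exists (z :: p); split=> //=.
- by rewrite zp andbT; apply/asboolP; exists a.
- by rewrite pu.
- by move=> s; rewrite inE => /orP[/eqP ->|/Pp].
Qed.

Lemma path_walk x p : path (adj (G := G)) x p ->
  exists2 u, walk edge x u (last x p) & size u = size p.
Proof.
elim: p x => [|y p IH] x /=; first by exists [::].
move=> /andP[/asboolP[a xy] /IH[u yp <-]]; exists (a :: u) => //.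
by exists y.
Qed.

End Adjacency.

Lemma relators_bounded (A : finType) (R : seq (word A * word A)) :
  exists N, forall u v, (u, v) \in R -> size u <= N /\ size v <= N.
Proof.
elim: R => [|[u0 v0] R [N IH]]; first by exists 0.
exists (N + (size u0 + size v0)) => u v; rewrite inE => /orP[/eqP[-> ->]|/IH[uN vN]].
  by rewrite addnCA leq_addr addnA leq_addl.
by split; [apply: leq_trans uN _|apply: leq_trans vN _]; exact: leq_addr.
Qed.

Theorem theorem4p5 (K : realType) (A : finType)
    (R : seq (word A * word A)) (w : word A) :
  tree_like K (adj (G := schutzenberger R w)) ->
  rational_language (Geo R w).
Proof.
move=> tree; set S := schutzenberger R w; set e := @ledge _ S.
have inv_e : inverse_graph e by exact: schutzenberger_inverse.
have walk_joined (x y : lvert S) u : walk e x u y ->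
    exists2 p, path (adj (G := S)) x p & last x p = y /\ size p = size u.
  move=> xy; have [|p [xp py pu _]] := @walk_path _ S (fun _ => True) x u y.
    by apply: walk_sub xy.
  by exists p.
have conn_e (x y : lvert S) : joined (adj (G := S)) x y.
  by have [u /walk_joined[p xp [py _]]] := schutzenberger_connected x y; exists p.
have sym_e : symmetric (adj (G := S)).
  by move=> x y; apply/asboolP/asboolP => -[a /inv_e.2 xy]; exists (invl a).
pose dist := path_dist (adj (G := S)).
have dist_le (x y : lvert S) u : walk e x u y -> dist x y <= size u.
  by move=> /walk_joined[p xp [<- <-]]; exact: path_dist_le.
have dist_ex (x y : lvert S) : exists2 u, walk e x u y & size u = dist x y.
  rewrite /dist; have [p [xp <- <-]] := path_distP (conn_e x y).
  by have [u xu <-] := path_walk xp; exists u.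
have [D narrow] := tree_like_bottleneck sym_e conn_e tree.
have [N short] := relators_bounded R.
pose o := base R w.
(* [base] is the vertex of w w^-1, and the minimal length of a label between given ends is
   [dist]. *)
suff -> : Geo R w = geodesics e o (dist o).
  apply: (@geodesics_rational A R w (lvert S) e o inv_e _ _ _ N D short).
  - exact: schutzenberger_satisfies.
  - move=> V' e' o' inv' sat' w'; split=> [u y|u u' y x].
      exact: initial_readable.
    exact: initial_eq.
  - exact: base_readable.
  - by move=> u x; exact: dist_le.
  - by move=> x; exact: dist_ex.
  (* The bottleneck bound limits [dist x y], and a shortest word then witnesses membership in the
     ball. *)
  - move=> x y u dxy xy; have [p [xp py _ Pp]] := walk_path xy.
    have [h xh hE] := dist_ex x y; exists h => //; rewrite hE -py.
    apply: (narrow o (dist o x)) => //; last by rewrite py.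
    by move=> s; rewrite inE => /orP[/eqP ->|/Pp].
apply/seteqP; split=> u.
  move=> [x [y [xE yE xy umin]]]; have -> : o = x by exact: val_inj.
  exists y => //; apply/eqP; rewrite eqn_leq dist_le //=.
  by have [v xv <-] := dist_ex x y; exact: umin.
move=> [y oy dy]; exists o, y; split=> //.
  by rewrite catA clsM; exact: (walk_schutzenberger o y u).1 oy.
by move=> v ov; rewrite -dy; exact: dist_le.
Qed.
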